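(* Let $p\ge 0$ be an integer and let $N_{2p+1}^{+}(s)$ be the number of eigenvalues, counted with multiplicity, in $(0,s]$ of the operator $\Box_c=-\frac{\partial^2}{\partial t^2}+c^2\Delta_x$ on $S^1\times S^2$ with $c=2p+1$; that is, $$N_{2p+1}^{+}(s)=\sum_{\substack{j\in\mathbb{Z},\ k\in\mathbb{Z}_{\ge 0}\\ 0<j^2-(2p+1)^2k(k+1)\le s}}(2k+1).$$ Then $$N_{2p+1}^{+}(s)=\frac{1}{(2p+1)^2}\left(\frac{\pi^2}{4}s^2-\frac{4}{3}s^{3/2}\right)+R_{N_{2p+1}^{+}}(s),\qquad R_{N_{2p+1}^{+}}(s)=O(s\log s)\quad\text{as } s\to\infty.$$
   Context: $S^1=\mathbb{R}/2\pi\mathbb{Z}$, $S^2$ is the standard unit sphere, and $\Delta_x$ is the (nonpositive) Laplacian on $S^2$. The eigenfunctions of $\Box_c$ are $e^{ijt}Y_k(x)$ with $j\in\mathbb{Z}$ and $Y_k$ a spherical harmonic of degree $k\ge 0$; the eigenvalue is $j^2-c^2k(k+1)$, and for each pair $(j,k)$ the corresponding space has dimension $2k+1$. The integer $p$ is fixed; the implied constant may depend on $p$. *)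

(* Defs.v *)
From mathcomp Require Import all_boot all_order all_algebra.
From mathcomp Require Import all_classical all_reals all_analysis.
Set Implicit Arguments.
Unset Strict Implicit.
Unset Printing Implicit Defensive.
Import Order.TTheory GRing.Theory Num.Theory.
Import numFieldNormedType.Exports.
Local Open Scope classical_set_scope.
Local Open Scope ring_scope.

(* Eigenvalue of Box_c = - d^2/dt^2 + c^2 Delta_x on S^1 x S^2 at
   e^{ijt} Y_k(x), Y_k a spherical harmonic of degree k; Delta_x is the
   nonpositive Laplacian, so Delta_x Y_k = - k (k + 1) Y_k. *)
Definition box_eigenvalue (R : realType) (c : R) (j : int) (k : nat) : R :=
  j%:~R ^+ 2 - c ^+ 2 * (k%:R * (k%:R + 1)).

(* Dimension of the eigenfunctions e^{ijt} Y_k(x) for fixed (j, k). *)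
Definition box_multiplicity (k : nat) : nat := (2 * k + 1)%N.

(* Number of eigenvalues of Box_c in (0, s], counted with multiplicity.  It is
   an extended real, equal to +oo when infinitely many pairs (j, k)
   contribute. *)
Definition Nplus (R : realType) (c s : R) : \bar R :=
  (\esum_(jk in [set jk : int * nat |
                  (0 < box_eigenvalue c jk.1 jk.2 <= s)%R])
    ((box_multiplicity jk.2)%:R)%:E)%E.

(* Main.v *)
Require Import Defs.
From mathcomp Require Import all_boot all_order all_algebra.
From mathcomp Require Import all_classical all_reals all_analysis.
From mathcomp Require Import zify ring lra.
Import Order.TTheory GRing.Theory Num.Theory.
Import numFieldNormedType.Exports.
Set Implicit Arguments.
Unset Strict Implicit.
Unset Printing Implicit Defensive.
Local Open Scope classical_set_scope.
Local Open Scope ring_scope.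

(** Put c = 2p + 1.  The proof turns the count into an explicit sum of squares
over odd numbers a, up to a bounded error.  As c is odd, a = 2j - c(2k + 1) is
an odd integer, and the eigenvalue l at (j, k) satisfies

   4 l = a^2 + 2 a c (2k + 1) + c^2.

For a = 2i + 1 > 0 the eigenvalue is automatically positive, and l <= s says
that 2k + 1 <= (4s - a^2 - c^2) / (2ac): k runs over an initial segment of
length N_i ([branch_length]), whose multiplicities 1 + 3 + 5 + ... add up to
N_i^2.  The symmetry j -> -j accounts for as many eigenvalues again.  The
remaining pairs, with |j| <= ck + p, carry positive eigenvalues only when
k <= p^2, so they contribute O(1), uniformly in s ([NplusE]).

Hence N(s) = 2 sum_i N_i^2 + O(1), where a <= 2 sqrt s.  Rounding N_i to
x_i = (4s - a^2) / (4ac) changes it by O(1), and x_i <= s / (i + 1), so the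
squares change by O(s sum_i 1 / (i + 1)) = O(s log s) ([sum_sqr_sub_le]).  This
is where the logarithm comes from; all other errors are O(s).  Finally

   2 sum_i x_i^2 = (1 / (8 c^2)) sum_(a odd, a <= 2t) (16 s^2 / a^2 - 8 s + a^2)

with t = sqrt s; the number of terms is within 1/2 of t, and the last two parts
are elementary sums.  For the first one needs the sum of 1 / a^2 over odd a to
precision O(1 / s): it is pi^2 / 8 minus a tail, squeezed between 1 / (4n + 2)
and 1 / (4n) after n terms ([odd_inv_sqr_sum_tail]).  The value pi^2 / 8 gives
the s^2 term; the tail, the term - 8 s and the sum of a^2 give
(- 4 - 8 + 4/3) s^(3/2), that is - (32/3) s^(3/2), before the division by
8 c^2.

The value pi^2 / 8 is obtained from the exact evaluation of the finite sums of
1 / sin^2 over the odd multiples of pi / 2^(n+2) in ]0, pi/2[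
([sum_invr_sqr_sin]), compared with 1 / x^2 through sin x <= x <= tan x. *)

(** * The sum of the inverse squares of the odd numbers *)

Lemma sin_le_id (R : realType) (x : R) : 0 <= x -> sin x <= x.
Proof.
move=> x0.
have dsin (y : R) : y \in `]0, x[ -> is_derive y 1 (@sin R) (cos y).
  by move=> _; exact: is_derive_sin.
have csin : {within `[0, x], continuous (@sin R)}.
  by apply: continuous_subspaceT => y; exact: continuous_sin.
have [c _] := MVT_segment x0 dsin csin; rewrite sin0 !subr0 => ->.
by rewrite ler_piMl// cos_le1.
Qed.

Lemma id_le_tan (R : realType) (x : R) : 0 <= x < pi / 2 -> x <= tan x.
Proof.
move=> /andP[x0 xpi].
have cpos (y : R) : 0 <= y <= x -> 0 < cos y.
  move=> /andP[y0 yx]; apply: cos_gt0_pihalf.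
  by apply/andP; split; [have := pi_gt0 R; lra|exact: le_lt_trans xpi].
have dtan (y : R) : y \in `]0, x[ -> is_derive y 1 (@tan R) (cos y ^- 2).
  rewrite in_itv/= => /andP[y0 yx]; apply: is_derive_tan.
  by rewrite gt_eqF// cpos// !ltW.
have ctan : {within `[0, x], continuous (@tan R)}.
  apply: continuous_in_subspaceT => y; rewrite inE/= in_itv/= => /cpos cy.
  by apply: continuous_tan; rewrite gt_eqF.
have [c] := MVT_segment x0 dtan ctan; rewrite in_itv/= tan0 !subr0 => /cpos cc ->.
by rewrite ler_peMl// invf_ge1 ?exprn_gt0// exprn_ile1 ?cos_le1 ?ltW.
Qed.

(** This is sin x <= x <= tan x in squared form, since 1 / tan^2 = 1 / sin^2 - 1:
replacing 1 / x^2 by 1 / sin^2 x costs at most 1, whatever x is. *)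
Lemma invr_sqr_sin_bounds (R : realType) (x : R) : 0 < x < pi / 2 ->
  (sin x ^+ 2)^-1 - 1 <= (x ^+ 2)^-1 <= (sin x ^+ 2)^-1.
Proof.
move=> /andP[x0 xpi].
have s0 : 0 < sin x by apply: sin_gt0_pihalf; rewrite x0.
have c0 : 0 < cos x.
  by apply: cos_gt0_pihalf; rewrite xpi andbT; have := pi_gt0 R; lra.
have sx := sin_le_id (ltW x0).
have xt : x * cos x <= sin x.
  by rewrite -ler_pdivlMr//; apply: id_le_tan; rewrite ltW.
apply/andP; split.
  have -> : (sin x ^+ 2)^-1 - 1 = (cos x ^+ 2) / (sin x ^+ 2).
    by rewrite cos2sin2; field; rewrite gt_eqF.
  rewrite ler_pdivrMr ?exprn_gt0// ler_pdivlMl ?exprn_gt0//.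
  rewrite -exprMn; apply: lerXn2r => //; rewrite nnegrE.
    by rewrite mulr_ge0// ltW.
  exact: ltW.
rewrite lef_pV2 ?posrE ?exprn_gt0//.
by apply: lerXn2r => //; rewrite nnegrE ltW.
Qed.

(** Since sin x = 2 sin (x/2) cos (x/2), this is
1 / sin^2 + 1 / cos^2 = 1 / (sin^2 cos^2) at x / 2, with the cosine written as
the sine of the complementary angle so that it can be iterated. *)
Lemma invr_sqr_sin_half (R : realType) (x : R) : 0 < x < pi / 2 ->
  (sin (x / 2) ^+ 2)^-1 + (sin (pi / 2 - x / 2) ^+ 2)^-1
  = 4 * (sin x ^+ 2)^-1.
Proof.
move=> /andP[x0 xpi].
have s0 : 0 < sin (x / 2) by apply: sin_gt0_pihalf; lra.
have c0 : 0 < cos (x / 2) by apply: cos_gt0_pihalf; lra.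
have -> : sin (pi / 2 - x / 2) = cos (x / 2).
  by rewrite addrC sinDpihalf cosN.
have {3}-> : x = (x / 2) *+ 2 by rewrite mulr2n; field.
rewrite sin_mulr2n.
have cE := cos2sin2 (x / 2).
rewrite -(mulr_natr (cos _ * _)) exprMn exprMn cE.
have : 1 - sin (x / 2) ^+ 2 != 0 by rewrite -cE expf_neq0// gt_eqF.
by move=> h; field; rewrite h gt_eqF.
Qed.

(** Halving the odd multiples of pi / 2^(n+2) below pi / 2 and adding the
complements of the halves yields each odd multiple of pi / 2^(n+3) below pi / 2
once, so by [invr_sqr_sin_half] the sum is multiplied by 4 from n to n + 1. *)
Lemma sum_invr_sqr_sin (R : realType) (n : nat) :
  \sum_(0 <= k < 2 ^ n) (sin ((2 * k + 1)%:R * pi / 2 ^+ (n + 2) : R) ^+ 2)^-1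
  = 2 * 4 ^+ n.
Proof.
elim: n => [|n IHn].
  rewrite big_nat1 expr0 mulr1.
  have p0 := pi_gt0 R.
  have h : 0 < (pi / 2 : R) / 2 < pi / 2 by lra.
  have s0 : 0 < sin (pi / 2 / 2 : R).
    by apply: sin_gt0_pihalf.
  have hp : 0 < sin (pi / 2 / 2 : R) ^+ 2 by rewrite exprn_gt0.
  have := @sin2cos2 R (pi / 2 / 2).
  have -> : cos (pi / 2 / 2 : R) = sin (pi / 2 / 2).
    rewrite -[LHS]sinDpihalf -[RHS]opprK -sinN -sinDpi.
    by congr sin; field.
  have -> : (2 * 0 + 1)%:R * pi / 2 ^+ (0 + 2) = pi / 2 / 2 :> R.
    by rewrite muln0 add0n; field.
  move=> h2; have -> : sin (pi / 2 / 2 : R) ^+ 2 = 2^-1 by lra.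
  by rewrite invrK.
rewrite exprS [RHS]mulrCA -IHn mulr_sumr.
have e2 : (2 ^ n.+1 = 2 ^ n + 2 ^ n)%N by rewrite expnS mul2n addnn.
(* The upper half of the new indices, in reverse order, lists the complements
   of the angles of the lower half. *)
rewrite (@big_cat_nat _ _ _ (2 ^ n)%N) ?e2 ?leq_addr//=.
rewrite -{2}[(2 ^ n)%N]add0n big_addn addnK.
rewrite [X in _ + X]big_nat_rev/= -big_split/=.
rewrite big_nat [RHS]big_nat; apply: eq_bigr => k /andP[_ kn].
have p0 := pi_gt0 R.
have N0 : 0 < 2 ^+ n :> R by rewrite exprn_gt0.
set x := (2 * k + 1)%:R * pi / 2 ^+ (n + 2) : R.
have k1 : (2 * k + 1)%:R < 2 * 2 ^+ n :> R.
  rewrite -natrX -natrM ltr_nat; lia.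
rewrite -invr_sqr_sin_half; last first.
  apply/andP; split.
    by rewrite divr_gt0// ?exprn_gt0// mulr_gt0// ltr0n addn1.
  rewrite /x exprD ltr_pdivrMr ?mulr_gt0// ?exprn_gt0//.
  have -> : pi / 2 * (2 ^+ n * 2 ^+ 2) = (2 * 2 ^+ n) * pi :> R by field.
  by rewrite ltr_pM2r.
congr ((sin _ ^+ 2)^-1 + (sin _ ^+ 2)^-1).
  by rewrite /x addSn exprS; field; rewrite gt_eqF// exprn_gt0.
have -> : (2 * (0 + 2 ^ n - k.+1 + 2 ^ n) + 1)%:R =
    4 * 2 ^+ n - (2 * k + 1)%:R :> R.
  rewrite -natrX -natrM -natrB; last by lia.
  by congr _%:R; lia.
rewrite /x addSn exprS exprD; field.
by rewrite gt_eqF.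
Qed.

Definition odd_inv_sqr_sum (R : realType) (n : nat) : R :=
  \sum_(0 <= k < n) ((2 * k + 1)%:R ^+ 2)^-1.

(** There are 2^n angles, each with an error at most 1 in
[invr_sqr_sin_bounds], against a total of 2 * 4^n; scaling by
pi^2 / (16 * 4^n) leaves an error of order 2^-n. *)
Lemma odd_inv_sqr_sum_pow2 (R : realType) (n : nat) :
  pi ^+ 2 / 8 - pi ^+ 2 / 16 / 2 ^+ n <= odd_inv_sqr_sum R (2 ^ n)
    <= pi ^+ 2 / 8.
Proof.
have p0 := pi_gt0 R.
have N0 : 0 < 2 ^+ n :> R by rewrite exprn_gt0.
have E4 : 4 ^+ n = (2 ^+ n) ^+ 2 :> R by rewrite -exprM mulnC exprM; congr (_ ^+ n); ring.
have bnd k : (k < 2 ^ n)%N ->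
   (sin ((2 * k + 1)%:R * pi / 2 ^+ (n + 2) : R) ^+ 2)^-1 - 1 <=
   16 * 4 ^+ n / pi ^+ 2 * ((2 * k + 1)%:R ^+ 2)^-1 <=
   (sin ((2 * k + 1)%:R * pi / 2 ^+ (n + 2) : R) ^+ 2)^-1.
  move=> kn.
  have k0 : 0 < (2 * k + 1)%:R :> R by rewrite ltr0n addn1.
  have k1 : (2 * k + 1)%:R < 2 * 2 ^+ n :> R.
    by rewrite -natrX -natrM ltr_nat; lia.
  set x := (2 * k + 1)%:R * pi / 2 ^+ (n + 2) : R.
  have -> : 16 * 4 ^+ n / pi ^+ 2 * ((2 * k + 1)%:R ^+ 2)^-1 = (x ^+ 2)^-1.
    rewrite /x exprD E4; clear x k1; move: (@pi R) p0 (_%:R) k0 (2 ^+ n) N0.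
    by move=> q q0 r r0 N N0; field; rewrite !gt_eqF.
  apply: invr_sqr_sin_bounds; apply/andP; split.
    by rewrite divr_gt0// ?exprn_gt0// mulr_gt0.
  rewrite /x exprD ltr_pdivrMr ?mulr_gt0// ?exprn_gt0//.
  have -> : pi / 2 * (2 ^+ n * 2 ^+ 2) = (2 * 2 ^+ n) * pi :> R by field.
  by rewrite ltr_pM2r.
have S := sum_invr_sqr_sin R n.
have up : 16 * 4 ^+ n / pi ^+ 2 * odd_inv_sqr_sum R (2 ^ n) <= 2 * 4 ^+ n.
  rewrite -S mulr_sumr; apply: ler_sum_nat => k /andP[_ kn].
  by have /andP[] := bnd k kn.
have lo : 2 * 4 ^+ n - 2 ^+ n <= 16 * 4 ^+ n / pi ^+ 2 * odd_inv_sqr_sum R (2 ^ n).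
  rewrite -S mulr_sumr.
  have -> : 2 ^+ n = \sum_(0 <= k < 2 ^ n) 1 :> R.
    by rewrite big_const_nat subn0 iter_addr_0 natrX.
  rewrite -sumrB; apply: ler_sum_nat => k /andP[_ kn].
  by have /andP[] := bnd k kn.
have C0 : 0 < 16 * 4 ^+ n / pi ^+ 2 :> R.
  by rewrite divr_gt0 ?mulr_gt0 ?exprn_gt0.
apply/andP; split; rewrite -(ler_pM2l C0).
  apply: le_trans lo; rewrite le_eqVlt; apply/orP; left; apply/eqP.
  rewrite E4; move: (@pi R) p0 (2 ^+ n) N0 => q q0 N N0.
  by field; rewrite !gt_eqF.
apply: (le_trans up); rewrite le_eqVlt; apply/orP; left; apply/eqP.
rewrite E4; move: (@pi R) p0 (2 ^+ n) N0 => q q0 N N0.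
by field; rewrite !gt_eqF.
Qed.

(** The two bounding expressions telescope, because
1 / (2 (2y + 1)) - 1 / (2 (2y + 3)) <= 1 / (2y + 1)^2
  <= 1 / (4y) - 1 / (4 (y + 1)). *)
Lemma odd_inv_sqr_sum_increment (R : realType) (n m : nat) :
  (0 < n)%N -> (n <= m)%N ->
  (4 * n%:R + 2)^-1 - (4 * m%:R + 2)^-1
    <= odd_inv_sqr_sum R m - odd_inv_sqr_sum R n
    <= (4 * n%:R)^-1 - (4 * m%:R)^-1.
Proof.
move=> n0 /subnKC <-; elim: (m - n)%N => [|d /andP[lo up]].
  by rewrite addn0 !subrr lexx.
have E : odd_inv_sqr_sum R (n + d.+1) =
    odd_inv_sqr_sum R (n + d) + ((2 * (n + d) + 1)%:R ^+ 2)^-1.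
  by rewrite /odd_inv_sqr_sum addnS big_nat_recr.
rewrite E; have y0 : 0 < (n + d)%:R :> R by rewrite ltr0n; lia.
have -> : (2 * (n + d) + 1)%:R = 2 * (n + d)%:R + 1 :> R by rewrite natrD natrM.
move: lo up; rewrite addnS -[(n + d).+1%:R]natr1.
set y := (n + d)%:R in y0 *.
move=> lo up.
have lo1 : (4 * y + 2)^-1 - (4 * (y + 1) + 2)^-1 <= ((2 * y + 1) ^+ 2)^-1.
  rewrite -subr_ge0.
  have -> : ((2 * y + 1) ^+ 2)^-1 - ((4 * y + 2)^-1 - (4 * (y + 1) + 2)^-1)
    = 2 / ((2 * y + 1) ^+ 2 * (2 * y + 3)).
    field; lra.
  by rewrite divr_ge0// mulr_ge0 ?sqr_ge0//; lra.
have up1 : ((2 * y + 1) ^+ 2)^-1 <= (4 * y)^-1 - (4 * (y + 1))^-1.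
  rewrite -subr_ge0.
  have -> : (4 * y)^-1 - (4 * (y + 1))^-1 - ((2 * y + 1) ^+ 2)^-1
    = 1 / (4 * y * (y + 1) * (2 * y + 1) ^+ 2).
    field; lra.
  by rewrite divr_ge0// mulr_ge0 ?sqr_ge0//; nra.
by apply/andP; split; lra.
Qed.

Lemma ler_of_ler_add_pow2 (R : realType) (a b c : R) (m : nat) :
  (forall n, (m <= n)%N -> a <= b + c / 2 ^+ n) -> a <= b.
Proof.
move=> h; apply/ler_addgt0Pl => e e0.
pose n := maxn m (Num.trunc (`|c| / e)).+1.
apply: (le_trans (h n (leq_maxl _ _))).
rewrite addrC lerD2r; apply: (@le_trans _ _ (`|c| / 2 ^+ n)).
  by rewrite ler_wpM2r ?invr_ge0 ?exprn_ge0// ler_norm.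
rewrite ler_pdivrMr ?exprn_gt0// mulrC -ler_pdivrMr//.
apply: (le_trans (ltW (truncnS_gt _))).
rewrite -natrX ler_nat.
exact: leq_trans (leq_maxr _ _) (ltnW (ltn_expl _ _)).
Qed.

(** Let m tend to infinity along the powers of 2 in
[odd_inv_sqr_sum_increment], where [odd_inv_sqr_sum_pow2] locates the sum. *)
Lemma odd_inv_sqr_sum_tail (R : realType) (n : nat) : (0 < n)%N ->
  (4 * n%:R + 2)^-1 <= pi ^+ 2 / 8 - odd_inv_sqr_sum R n <= (4 * n%:R)^-1.
Proof.
move=> n0; rewrite lerBrDr lerBlDr; apply/andP; split.
  apply: (@ler_of_ler_add_pow2 R _ _ 1 n) => k nk.
  have nk2 : (n <= 2 ^ k)%N by exact: leq_trans nk (ltnW (ltn_expl _ _)).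
  have /andP[lo _] := odd_inv_sqr_sum_increment R n0 nk2.
  have /andP[_ up] := odd_inv_sqr_sum_pow2 R k.
  have K0 : 0 < 2 ^+ k :> R by rewrite exprn_gt0.
  have : (4 * (2 ^ k)%:R + 2)^-1 <= 1 / 2 ^+ k :> R.
    by rewrite natrX div1r lef_pV2 ?posrE; lra.
  lra.
apply: (@ler_of_ler_add_pow2 R _ _ (pi ^+ 2 / 16) n) => k nk.
have nk2 : (n <= 2 ^ k)%N by exact: leq_trans nk (ltnW (ltn_expl _ _)).
have /andP[_ up] := odd_inv_sqr_sum_increment R n0 nk2.
have /andP[lo _] := odd_inv_sqr_sum_pow2 R k.
have : 0 <= (4 * (2 ^ k)%:R)^-1 :> R by rewrite invr_ge0 mulr_ge0.
lra.
Qed.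

(** * Reduction of the count to a sum of squares *)

Lemma sum_odd_sqr (n : nat) : (\sum_(k < n) (2 * k + 1) = n ^ 2)%N.
Proof.
elim: n => [|n IHn]; first by rewrite big_ord0.
by rewrite big_ord_recr/= IHn; ring.
Qed.

(** The branch of index i is the set of pairs (j, k) with
2j - (2p + 1)(2k + 1) = 2i + 1.  Its eigenvalue is at most s exactly when
2k + 1 is at most the quotient below; [Num.trunc] vanishes on negative numbers,
so a branch whose quotient is below 1 gets length 0. *)
Definition branch_length (R : realType) (p : nat) (s : R) (i : nat) : nat :=
  let a : R := (2 * i + 1)%:R in
  let c : R := (2 * p + 1)%:R in
  Num.trunc (((4 * s - a ^+ 2 - c ^+ 2) / (2 * a * c) + 1) / 2).

(** The frequency j of the point of index k on the branch of index i. *)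
Definition branch_point (p : nat) (ik : nat * nat) : nat :=
  (ik.1 + 1 + (2 * p + 1) * ik.2 + p)%N.

Lemma box_eigenvalueN (R : realType) (c : R) (j : int) (k : nat) :
  box_eigenvalue c (- j) k = box_eigenvalue c j k.
Proof. by rewrite /box_eigenvalue mulrNz sqrrN. Qed.

Lemma box_eigenvalue_branch (R : realType) (p i k : nat) :
  let a : R := (2 * i + 1)%:R in
  let c : R := (2 * p + 1)%:R in
  4 * box_eigenvalue c (branch_point p (i, k)) k
  = a ^+ 2 + 2 * a * c * (2 * k%:R + 1) + c ^+ 2.
Proof.
rewrite /box_eigenvalue /branch_point/=.
rewrite -[_%:~R]/(_%:R) !(natrD, natrM).
by ring.
Qed.

Lemma branch_eigenvalue_itv (R : realType) (p : nat) (s : R) (i k : nat) :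
  (0 < box_eigenvalue ((2 * p + 1)%:R : R) (branch_point p (i, k)) k <= s)
  = (k < branch_length p s i)%N.
Proof.
rewrite /branch_length truncn_gt_nat.
have := box_eigenvalue_branch R p i k => /=.
set l := box_eigenvalue _ _ _.
have : 0 < (2 * i + 1)%:R :> R by rewrite ltr0n addn1.
have : 0 < (2 * p + 1)%:R :> R by rewrite ltr0n addn1.
move: (2 * i + 1)%:R (2 * p + 1)%:R => a c c0 a0 lE.
have k0 : 0 <= k%:R :> R by [].
have ack : 0 <= 2 * a * c * (2 * k%:R + 1).
  by rewrite mulr_ge0 ?mulr_ge0//; lra.
have l0 : 0 < l.
  have := exprn_gt0 2 a0; have := exprn_gt0 2 c0; lra.
rewrite l0/= ler_pdivlMr// -lerBlDr ler_pdivlMr ?mulr_gt0//.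
have -> : (k.+1%:R * 2 - 1) * (2 * a * c) = 2 * a * c * (2 * k%:R + 1) :> R.
  by rewrite -natr1; ring.
by apply/idP/idP => h; lra.
Qed.

(** Write j = ck + r with c = 2p + 1.  Positivity of the eigenvalue forces
r > 0 and c (c - 2r) k < r^2; here r <= p gives c - 2r >= 1, so k is bounded in
terms of p alone. *)
Lemma small_positive_eigenvalue (p k j : nat) :
  (((2 * p + 1) ^ 2 * (k * (k + 1)) < j ^ 2)%N) ->
  (j <= (2 * p + 1) * k + p)%N ->
  (k <= p ^ 2)%N.
Proof.
move=> h1 h2.
have ck : ((2 * p + 1) * k < j)%N.
  rewrite -ltn_sqr; apply: leq_ltn_trans h1.
  by rewrite expnMn leq_pmul2l ?expn_gt0 ?addn1// -mulnn leq_mul// leq_addr.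
have [r jE] : exists r, j = ((2 * p + 1) * k + r)%N.
  by exists (j - (2 * p + 1) * k)%N; lia.
have rp : (r <= p)%N by lia.
subst j.
nia.
Qed.

(** A finite set, independent of s, which contains the pairs that carry a
positive eigenvalue but lie on no branch and on no mirror image of one. *)
Definition exceptional (p : nat) : set (int * nat) :=
  [set jk | (`|jk.1| <= (2 * p + 1) * p ^ 2 + p)%N /\ (jk.2 <= p ^ 2)%N].

Lemma finite_exceptional (p : nat) : finite_set (exceptional p).
Proof.
pose N := ((2 * p + 1) * p ^ 2 + p)%N.
apply: (@sub_finite_set _ _
  ((Posz @` `I_N.+1 `|` (fun n : nat => - n%:Z) @` `I_N.+1) `*` `I_(p ^ 2).+1)).
  move=> [j k] [/= hj hk]; split; last by rewrite /= ltnS.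
  have [j0|j0] := leP 0 j.
    by left; exists `|j|%N; [rewrite /= ltnS|lia].
  by right; exists `|j|%N; [rewrite /= ltnS|lia].
by apply: finite_setX; rewrite ?finite_setU; try split;
   try apply: finite_image; exact: finite_II.
Qed.

Lemma esum_branch (R : realType) (p : nat) (s : R) (m : nat) :
  (forall i, (m <= i)%N -> branch_length p s i = 0%N) ->
  (\esum_(ik in [set ik : nat * nat | (ik.2 < branch_length p s ik.1)%N])
     ((box_multiplicity ik.2)%:R : R)%:E
  = (\sum_(i < m) (branch_length p s i)%:R ^+ 2)%:E)%E.
Proof.
move=> hm.
have -> : [set ik : nat * nat | (ik.2 < branch_length p s ik.1)%N] =
    `I_m `*`` (fun i => `I_(branch_length p s i)).
  apply/seteqP; split => [[i k]|[i k] []]//= h; split => //=.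
  by rewrite ltnNge; apply/negP => /hm h0; rewrite h0 in h.
rewrite -(@esum_esum _ _ _ _ _ (fun i k => (box_multiplicity k)%:R%:E)); last first.
  by move=> i j _ _; rewrite lee_fin.
transitivity (\esum_(i in `I_m) ((branch_length p s i)%:R ^+ 2 : R)%:E)%E.
  apply: eq_esum => i _; rewrite esum_fset ?finite_II//.
  rewrite -fsbig_ord sumEFin -natr_sum -natrX; congr (_%:R%:E).
  exact: sum_odd_sqr.
rewrite esum_fset ?finite_II//.
by rewrite -fsbig_ord sumEFin.
Qed.

(** The branches and their mirror images under j -> -j, which are the pairs with
|j| > ck + p, contribute equally; C is the total multiplicity of
[exceptional]. *)
Lemma NplusE (R : realType) (p : nat) : exists C : R, forall (s : R) (m : nat),
  (forall i, (m <= i)%N -> branch_length p s i = 0%N) ->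
  exists2 e : R, 0 <= e <= C &
    Nplus (2 * p + 1)%:R s =
    (2 * \sum_(i < m) (branch_length p s i)%:R ^+ 2 + e)%:E.
Proof.
pose c : R := (2 * p + 1)%:R.
pose mult (jk : int * nat) : \bar R := (box_multiplicity jk.2)%:R%:E.
exists (fine (\esum_(jk in exceptional p) mult jk)%E) => s m hm.
set A := [set jk : int * nat | 0 < box_eigenvalue c jk.1 jk.2 <= s].
set T := [set ik : nat * nat | (ik.2 < branch_length p s ik.1)%N].
pose B1 := [set jk : int * nat | ((2 * p + 1) * jk.2 + p)%N%:Z < jk.1].
pose B2 := [set jk : int * nat | ((2 * p + 1) * jk.2 + p)%N%:Z < - jk.1].
have mult0 jk : (0 <= mult jk)%E by rewrite lee_fin.
have bij1 : set_bij T (A `&` B1) (fun ik => ((branch_point p ik)%:Z, ik.2)).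
  split.
  - move=> [i k] /= Tik; split.
      by rewrite /A/= branch_eigenvalue_itv.
    by rewrite /B1/= /branch_point/=; lia.
  - move=> [i k] [i' k'] _ _; rewrite /branch_point/=.
    by case=> /[swap] -> h; congr pair; lia.
  - move=> [j k] [/= Ajk Bjk]; rewrite /B1/= in Bjk.
    have E : j = (branch_point p (`|j|%N - ((2 * p + 1) * k + p).+1, k)%N)%:Z.
      rewrite /branch_point/=; lia.
    exists (`|j|%N - ((2 * p + 1) * k + p).+1, k)%N; last by rewrite /= -E.
    by rewrite /T/= -branch_eigenvalue_itv -E.
have bij2 : set_bij T ((A `&` ~` B1) `&` B2) (fun ik => (- (branch_point p ik)%:Z, ik.2)).
  split.
  - move=> [i k] /= Tik; split; [split|].
    + by rewrite /A/= box_eigenvalueN branch_eigenvalue_itv.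
    + by rewrite /B1/= /branch_point/=; lia.
    + by rewrite /B2/= /branch_point/=; lia.
  - move=> [i k] [i' k'] _ _; rewrite /branch_point/=.
    by case=> /[swap] -> h; congr pair; lia.
  - move=> [j k] [[/= Ajk _] Bjk]; rewrite /B2/= in Bjk.
    have E : j = - (branch_point p (`|j|%N - ((2 * p + 1) * k + p).+1, k)%N)%:Z.
      rewrite /branch_point/=; lia.
    exists (`|j|%N - ((2 * p + 1) * k + p).+1, k)%N; last by rewrite /= -E.
    by rewrite /T/= -branch_eigenvalue_itv -box_eigenvalueN -E.
have excep : (A `&` ~` B1) `&` ~` B2 `<=` exceptional p.
  move=> [j k] [[/= /andP[l0 _] nB1] nB2].
  have jle : (`|j| <= (2 * p + 1) * k + p)%N.
    by move: nB1 nB2; rewrite /B1 /B2/= => /negP h1 /negP h2; lia.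
  have kp : (k <= p ^ 2)%N.
    apply: (@small_positive_eigenvalue p k `|j|) => //.
    rewrite -(ltr_nat R) [X in X < _]natrM !natrX [X in _ * X]natrM (natrD _ k).
    move: l0; rewrite /box_eigenvalue subr_gt0.
    suff -> : j%:~R ^+ 2 = `|j|%:R ^+ 2 :> R by [].
    by rewrite natr_absz intr_norm real_normK// num_real.
  split => //=; apply: (leq_trans jle); rewrite leq_add2r leq_mul2l.
  by rewrite kp orbT.
have E : (\esum_(jk in (A `&` ~` B1) `&` ~` B2) mult jk
    <= \esum_(jk in exceptional p) mult jk)%E.
  rewrite -[X in (X <= _)%E](_ : \esum_(jk in
    exceptional p `&` ((A `&` ~` B1) `&` ~` B2)) mult jk = _)%E.
    rewrite esum_mkcondr; apply: le_esum => jk _.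
    by case: ifP.
  by congr esum; apply/setIidPr.
have fin_exc : (\esum_(jk in exceptional p) mult jk \is a fin_num)%E.
  rewrite esum_fset//; last exact: finite_exceptional.
  have := finite_exceptional p => /finite_fsetP[F ->].
  by rewrite fsbig_finite//= sumEFin.
have E0 : (0 <= \esum_(jk in (A `&` ~` B1) `&` ~` B2) mult jk)%E.
  exact: esum_ge0.
have fin_rest : (\esum_(jk in (A `&` ~` B1) `&` ~` B2) mult jk \is a fin_num)%E.
  rewrite ge0_fin_numE//; apply: (le_lt_trans E).
  by rewrite -ge0_fin_numE//; exact: esum_ge0.
exists (fine (\esum_(jk in (A `&` ~` B1) `&` ~` B2) mult jk)%E).
  by apply/andP; split; [exact: fine_ge0|exact: fine_le].
rewrite /Nplus (esumID B1)// -/A.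
rewrite (esumID B2 (A `&` ~` B1))//.
rewrite (@reindex_esum _ _ _ _ _ _ _ bij1) (@reindex_esum _ _ _ _ _ _ _ bij2)/=.
rewrite (esum_branch hm) -[X in (_ + (_ + X))%E](fineK fin_rest).
by rewrite -!EFinD; congr (_%:E); ring.
Qed.

(** * Asymptotics of the sum of squares *)

(** The number of odd a with a <= 2t; only these branches can be nonempty
for s = t^2. *)
Definition cutoff (R : realType) (t : R) : nat := Num.trunc (t + 2^-1).

Lemma ltn_cutoff (R : realType) (t : R) (i : nat) :
  (i < cutoff t)%N = ((2 * i + 1)%:R <= 2 * t).
Proof.
rewrite /cutoff truncn_gt_nat -natr1 natrD natrM.
by apply/idP/idP => h; lra.
Qed.

Lemma cutoff_dist (R : realType) (t : R) : 0 <= t -> `|(cutoff t)%:R - t| <= 2^-1.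
Proof.
move=> t0; have /truncn_itv/andP[] : 0 <= t + 2^-1 by lra.
rewrite -/(cutoff t) -[(cutoff t).+1%:R]natr1 => lo up; rewrite ler_norml; apply/andP; split; lra.
Qed.

Lemma branch_length_out (R : realType) (p : nat) (t : R) (i : nat) : 0 <= t ->
  (cutoff t <= i)%N -> branch_length p (t ^+ 2) i = 0%N.
Proof.
move=> t0; rewrite leqNgt ltn_cutoff -ltNge /branch_length => ta.
apply/eqP; rewrite eqn0Ngt truncn_gt0 -ltNge.
have : 0 < (2 * i + 1)%:R :> R by rewrite ltr0n addn1.
have : 0 < (2 * p + 1)%:R :> R by rewrite ltr0n addn1.
move: (2 * i + 1)%:R (2 * p + 1)%:R ta => a c ta c0 a0.
have ac : 0 < 2 * a * c by rewrite !mulr_gt0.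
have : (4 * t ^+ 2 - a ^+ 2 - c ^+ 2) / (2 * a * c) <= 0.
  by rewrite pmulr_lle0 ?invr_gt0//; nra.
lra.
Qed.

(** The argument of [Num.trunc] in [branch_length] without its bounded part
1/2 - c / (4a). *)
Definition branch_main (R : realType) (p : nat) (s : R) (i : nat) : R :=
  let a : R := (2 * i + 1)%:R in (4 * s - a ^+ 2) / (4 * a * (2 * p + 1)%:R).

Lemma branch_length_approx (R : realType) (p : nat) (t : R) (i : nat) : 0 <= t ->
  (i < cutoff t)%N ->
  `|(branch_length p (t ^+ 2) i)%:R - branch_main p (t ^+ 2) i|
    <= (2 * p + 1)%:R + 2.
Proof.
move=> t0; rewrite ltn_cutoff /branch_length /branch_main => ta.
have : 1 <= (2 * i + 1)%:R :> R by rewrite ler1n addn1.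
have : 1 <= (2 * p + 1)%:R :> R by rewrite ler1n addn1.
move: (2 * i + 1)%:R (2 * p + 1)%:R ta => a c ta c1 a1.
have ac : 0 < 4 * a * c by rewrite !mulr_gt0//; lra.
set y := (_ / (2 * a * c) + 1) / 2; set x := (_ / (4 * a * c)).
have xy : y = x - c / (4 * a) + 2^-1 by rewrite /y /x; field; lra.
have x0 : 0 <= x by rewrite divr_ge0 ?(ltW ac)//; nra.
have ca : 0 <= c / (4 * a) <= c.
  rewrite divr_ge0/= ?ler_pdivrMr ?mulr_gt0//; try nra; lra.
have hgt := truncnS_gt y; rewrite -[(Num.trunc y).+1%:R]natr1 in hgt.
have hle : (Num.trunc y)%:R <= x + 1.
  have [y0|y0] := leP 0 y; first by have := truncn_le y; rewrite y0; lra.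
  have -> : Num.trunc y = 0%N.
    by apply/eqP; rewrite eqn0Ngt truncn_gt0 -ltNge; lra.
  lra.
rewrite ler_norml; apply/andP; split; lra.
Qed.

(** Since a = 2i + 1 >= i + 1 and c >= 1. *)
Lemma branch_main_bounds (R : realType) (p : nat) (t : R) (i : nat) : 0 <= t ->
  (i < cutoff t)%N ->
  0 <= branch_main p (t ^+ 2) i <= t ^+ 2 / i.+1%:R.
Proof.
move=> t0; rewrite ltn_cutoff /branch_main => ta.
have : 1 <= (2 * p + 1)%:R :> R by rewrite ler1n addn1.
have i0 : 0 <= i%:R :> R by [].
move: (2 * p + 1)%:R ta => c; rewrite natrD natrM -[i.+1%:R]natr1 => ta c1.
have ac : 0 < 4 * (2 * i%:R + 1) * c by rewrite !mulr_gt0//; lra.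
apply/andP; split; first by rewrite divr_ge0 ?(ltW ac)//; nra.
rewrite ler_pdivrMr// [X in _ <= X]mulrAC ler_pdivlMr; last by lra.
apply: (@le_trans _ _ (4 * t ^+ 2 * (i%:R + 1))).
  by rewrite ler_wpM2r//; nra.
have -> : t ^+ 2 * (4 * (2 * i%:R + 1) * c) = 4 * t ^+ 2 * ((2 * i%:R + 1) * c) by ring.
by rewrite ler_wpM2l ?mulr_ge0 ?sqr_ge0//; nra.
Qed.

Lemma harmonic_le_ln (R : realType) (n : nat) :
  \sum_(i < n.+1) (i.+1%:R)^-1 <= 1 + ln n.+1%:R :> R.
Proof.
elim: n => [|n IHn]; first by rewrite big_ord1 ln1 invr1 addr0.
rewrite big_ord_recr/=.
have n0 : 0 < n.+1%:R :> R by rewrite ltr0n.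
have n20 : 0 < n.+2%:R :> R by rewrite ltr0n.
have e : n.+2%:R = n.+1%:R + 1 :> R by rewrite natr1.
have h : ln (n.+1%:R / n.+2%:R) <= - n.+2%:R^-1 :> R.
  have -> : n.+1%:R / n.+2%:R = 1 + - n.+2%:R^-1 :> R.
    by rewrite e; field; lra.
  by apply: le_ln1Dx; rewrite ltrN2 invf_lt1// e; lra.
rewrite ln_div ?posrE// in h.
rewrite e in h *; move: IHn h; clear; lra.
Qed.

(** With C = c + 2, each term is |N - x| (N + x) <= C (2x + C), and
x <= t^2 / (i + 1) sums to a multiple of t^2 times a harmonic sum. *)
Lemma sum_sqr_sub_le (R : realType) (p : nat) (t : R) : 2 <= t ->
  `|\sum_(i < cutoff t) (branch_length p (t ^+ 2) i)%:R ^+ 2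
    - \sum_(i < cutoff t) branch_main p (t ^+ 2) i ^+ 2|
  <= ((2 * p + 1)%:R + 2) * (2 * t ^+ 2 * (1 + ln (t ^+ 2))
       + ((2 * p + 1)%:R + 2) * t ^+ 2).
Proof.
move=> t2; have t0 : 0 <= t by lra.
set C := (2 * p + 1)%:R + 2.
have C0 : 0 <= C by rewrite /C addr_ge0.
rewrite -sumrB; apply: (le_trans (ler_norm_sum _ _ _)).
apply: (@le_trans _ _ (\sum_(i < cutoff t) C * (2 * t ^+ 2 * i.+1%:R^-1 + C))).
  apply: ler_sum => i _.
  have := @branch_length_approx R p t i t0 (ltn_ord i).
  have /andP[] := @branch_main_bounds R p t i t0 (ltn_ord i).
  rewrite -/C; move: (branch_length _ _ _)%:R (branch_main _ _ _) => N x x0 xle Nx.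
  rewrite subr_sqr normrM ler_pM//.
  have -> : N + x = N - x + 2 * x by ring.
  apply: (le_trans (ler_normD _ _)).
  rewrite addrC lerD// ger0_norm ?mulr_ge0// -mulrA.
  by rewrite ler_pM2l.
rewrite -mulr_sumr ler_wpM2l// big_split/= lerD//.
  rewrite -mulr_sumr ler_wpM2l ?mulr_ge0 ?sqr_ge0//.
  have := cutoff_dist t0; rewrite ler_norml => /andP[lo up].
  have cpos : (0 < cutoff t)%N by rewrite -(ltr_nat R); lra.
  rewrite -(prednK cpos); apply: (le_trans (harmonic_le_ln R _)).
  rewrite lerD2l (prednK cpos) ler_ln ?posrE ?ltr0n//; nra.
rewrite sumr_const card_ord -mulr_natl mulrC ler_wpM2l//.
have := cutoff_dist t0; rewrite ler_norml => /andP[lo up].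
nra.
Qed.

(** Expanding the square gives 16 s^2 / a^2 - 8 s + a^2, and
1 + 9 + ... + (2n - 1)^2 = n (4n^2 - 1) / 3. *)
Lemma sum_branch_main (R : realType) (p n : nat) (s : R) :
  2 * \sum_(i < n) branch_main p s i ^+ 2 =
  ((2 * p + 1)%:R ^+ 2)^-1 *
    ((16 * s ^+ 2 * odd_inv_sqr_sum R n - 8 * s * n%:R
      + n%:R * (4 * n%:R ^+ 2 - 1) / 3) / 8).
Proof.
have c0 : (2 * p + 1)%:R != 0 :> R by rewrite pnatr_eq0 addn1.
elim: n => [|n IHn].
  by rewrite big_ord0 /odd_inv_sqr_sum big_geq//; field.
rewrite big_ord_recr/= mulrDr IHn /odd_inv_sqr_sum big_nat_recr//= -/(odd_inv_sqr_sum R n).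
rewrite /branch_main -[n.+1%:R]natr1.
have a0 : (2 * n + 1)%:R != 0 :> R by rewrite pnatr_eq0 addn1.
have aE : (2 * n + 1)%:R = 2 * n%:R + 1 :> R by rewrite natrD natrM.
rewrite aE in a0 *.
move: (2 * p + 1)%:R c0 (odd_inv_sqr_sum R n) => c c0 O.
by field; rewrite a0 c0.
Qed.

(** With n = t + O(1) and tail tau = 1 / (4t) + O(1 / t^2), the parts of order
t^3 are - 16 t^4 tau ~ - 4 t^3, - 8 t^2 n ~ - 8 t^3 and 4 n^3 / 3 ~ 4 t^3 / 3. *)
Lemma main_sum_approx (R : realType) (t : R) : 2 <= t ->
  `|16 * (t ^+ 2) ^+ 2 * odd_inv_sqr_sum R (cutoff t)
    - 8 * t ^+ 2 * (cutoff t)%:R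
    + (cutoff t)%:R * (4 * (cutoff t)%:R ^+ 2 - 1) / 3
    - (2 * pi ^+ 2 * (t ^+ 2) ^+ 2 - 32 / 3 * t ^+ 3)|
  <= 13 * t ^+ 2.
Proof.
set n : R := (cutoff t)%:R.
move=> t2; have t0 : 0 <= t by lra.
have := cutoff_dist t0; rewrite ler_norml => /andP[lo up].
have cpos : (0 < cutoff t)%N by rewrite -(ltr_nat R); lra.
have /andP[] := odd_inv_sqr_sum_tail R cpos.
rewrite -/n in lo up *.
set tau := (pi ^+ 2 / 8 - odd_inv_sqr_sum R (cutoff t)) => tau_lo tau_up.
have -> : odd_inv_sqr_sum R (cutoff t) = pi ^+ 2 / 8 - tau.
  by rewrite /tau opprB addrC subrK.
move: (@pi R ^+ 2) tau tau_lo tau_up => P tau tau_lo tau_up.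
have -> : 16 * (t ^+ 2) ^+ 2 * (P / 8 - tau) - 8 * t ^+ 2 * n
    + n * (4 * n ^+ 2 - 1) / 3 - (2 * P * (t ^+ 2) ^+ 2 - 32 / 3 * t ^+ 3)
  = - (16 * t ^+ 4 * tau - 4 * t ^+ 3) - 8 * t ^+ 2 * (n - t)
    + 4 / 3 * ((n - t) * (n ^+ 2 + n * t + t ^+ 2)) - n / 3 by field.
have h1 : 16 * t ^+ 4 * tau - 4 * t ^+ 3 <= 4 * t ^+ 2.
  rewrite lerBlDr; apply: (@le_trans _ _ (16 * t ^+ 4 * (4 * t - 2)^-1)).
    rewrite ler_wpM2l ?mulr_ge0 ?exprn_ge0//.
    by apply: (le_trans tau_up); rewrite lef_pV2 ?posrE; lra.
  rewrite ler_pdivrMr; last by lra.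
  rewrite -subr_ge0.
  have -> : (4 * t ^+ 2 + 4 * t ^+ 3) * (4 * t - 2) - 16 * t ^+ 4 = 8 * t ^+ 2 * (t - 1) by ring.
  by rewrite mulr_ge0 ?mulr_ge0 ?sqr_ge0//; lra.
have h2 : - (4 * t ^+ 2) <= 16 * t ^+ 4 * tau - 4 * t ^+ 3.
  rewrite lerBrDr; apply: (@le_trans _ _ (16 * t ^+ 4 * (4 * t + 4)^-1)); last first.
    rewrite ler_wpM2l ?mulr_ge0 ?exprn_ge0//.
    by apply: (le_trans _ tau_lo); rewrite lef_pV2 ?posrE; lra.
  rewrite ler_pdivlMr; last by lra.
  rewrite -subr_ge0.
  have -> : 16 * t ^+ 4 - (- (4 * t ^+ 2) + 4 * t ^+ 3) * (4 * t + 4) = 16 * t ^+ 2 by ring.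
  by rewrite mulr_ge0 ?sqr_ge0.
have h3 : `|8 * t ^+ 2 * (n - t)| <= 4 * t ^+ 2.
  rewrite normrM ger0_norm ?mulr_ge0 ?sqr_ge0//.
  have -> : 4 * t ^+ 2 = 8 * t ^+ 2 * 2^-1 by field.
  by rewrite ler_wpM2l ?mulr_ge0 ?sqr_ge0// ler_norml; apply/andP; split; lra.
have h4 : `|(n - t) * (n ^+ 2 + n * t + t ^+ 2)| <= 2^-1 * (6 * t ^+ 2).
  rewrite normrM ler_pM//.
    by rewrite ler_norml; apply/andP; split; lra.
  by rewrite ger0_norm; nra.
have h5 : 0 <= n / 3 <= t ^+ 2 by apply/andP; split; nra.
have t2pos : 0 <= t ^+ 2 by rewrite sqr_ge0.
move: h3 h4; rewrite !ler_norml => /andP[? ?] /andP[? ?].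
by apply/andP; split; lra.
Qed.

Theorem theorem4p2 (R : realType) (p : nat) :
  exists Rem : R -> R,
    (forall s : R, 0 < s ->
       Nplus (2 * p + 1)%:R s =
       (((2 * p + 1)%:R ^+ 2)^-1 *
          (pi ^+ 2 / 4 * s ^+ 2 - 4 / 3 * s `^ (3 / 2)) + Rem s)%:E)
    /\ (exists2 K : R, 0 < K &
          \forall s \near +oo_ R, `|Rem s| <= K * `|s * ln s|).
Proof.
have [Cx Nx] := NplusE R p.
pose c : R := (2 * p + 1)%:R.
have c1 : 1 <= c by rewrite ler1n addn1.
pose main s : R := (c ^+ 2)^-1 * (pi ^+ 2 / 4 * s ^+ 2 - 4 / 3 * s `^ (3 / 2)).
have Nsqrt (s : R) : 0 <= s -> exists2 e : R, 0 <= e <= Cx &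
   Nplus c s = (2 * \sum_(i < cutoff (Num.sqrt s)) (branch_length p s i)%:R ^+ 2 + e)%:E.
  move=> s0; apply: Nx => i hi.
  by rewrite -(sqr_sqrtr s0); apply: branch_length_out.
exists (fun s => fine (Nplus c s) - main s); split.
  move=> s /ltW s0; have [e _ E] := Nsqrt s s0.
  by rewrite -/c -/(main s) addrC subrK E.
have Cx0 : 0 <= Cx.
  by have [e /andP[e0 /(le_trans e0)]] := Nsqrt 0 (lexx _).
(* Relative to s ln s, when ln s >= 1: Cx bounds the exceptional pairs,
   2 (c + 2) (4 + (c + 2)) twice the rounding error of the squares, and 13 the
   error in the explicit sum. *)
exists (Cx + 8 * (c + 2) + 2 * (c + 2) ^+ 2 + 13); first by nra.
near=> s.
have s4 : 4 <= s by near: s; exact: nbhs_pinfty_ge.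
have se : expR 1 <= s by near: s; exact: nbhs_pinfty_ge.
have s0 : 0 <= s by lra.
have l1 : 1 <= ln s by rewrite -(expRK 1) ler_ln ?posrE ?expR_gt0//; lra.
have [e /andP[e0 eC] ->] := Nsqrt s s0; rewrite /main.
set t := Num.sqrt s.
have tt : t ^+ 2 = s by rewrite sqr_sqrtr.
have t2 : 2 <= t.
  by rewrite -(@ler_pXn2r _ 2) ?nnegrE ?sqrtr_ge0// tt; lra.
have -> : s `^ (3 / 2) = t ^+ 3.
  have -> : 3 / 2 = 2^-1 * 3 :> R by rewrite mulrC.
  by rewrite powRrM powR12_sqrt// powR_mulrn ?sqrtr_ge0.
have h1 := sum_sqr_sub_le p t2.
have h2 := main_sum_approx t2.
have h3 := sum_branch_main p (cutoff t) s.
move: h1 h2; rewrite /= tt -/c in h3 *.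
set S1 := \sum_(i < _) (branch_length _ _ _)%:R ^+ 2.
set S2 := \sum_(i < _) (branch_main _ _ _) ^+ 2 in h3 *.
set Q := (16 * s ^+ 2 * _ - _ + _) in h3 *.
set M := (2 * pi ^+ 2 * s ^+ 2 - 32 / 3 * t ^+ 3).
move=> h1 h2.
have -> : 2 * S1 + e - (c ^+ 2)^-1 * (pi ^+ 2 / 4 * s ^+ 2 - 4 / 3 * t ^+ 3) =
   2 * (S1 - S2) + e + (c ^+ 2)^-1 * ((Q - M) / 8).
  have -> : 2 * (S1 - S2) = 2 * S1 - 2 * S2 by ring.
  by rewrite h3 /M; field; lra.
have h4 : `|(c ^+ 2)^-1 * ((Q - M) / 8)| <= 13 * s.
  rewrite normrM -[X in _ <= X]mul1r ler_pM//.
    by rewrite ger0_norm ?invr_ge0 ?sqr_ge0// invf_le1 ?exprn_ege1// exprn_gt0//; lra.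
  rewrite normrM (ger0_norm (_ : 0 <= 8^-1))//.
  have := normr_ge0 (Q - M); lra.
have sl : s <= s * ln s by rewrite ler_peMr//.
have -> : `|s * ln s| = s * ln s by rewrite ger0_norm//; lra.
have h5 : (c + 2) * (2 * s * (1 + ln s) + (c + 2) * s)
    <= (c + 2) * (4 * (s * ln s) + (c + 2) * (s * ln s)).
  rewrite ler_wpM2l; [by []|lra|].
  rewrite lerD ?ler_wpM2l//; lra.
have h6 : e <= Cx * (s * ln s).
  apply: (le_trans eC); rewrite ler_peMr//; lra.
apply: (le_trans (ler_normD _ _)).
apply: (le_trans (lerD (ler_normD _ _) (lexx _))).
rewrite normrM normr_nat (ger0_norm e0).
have : (Cx + 8 * (c + 2) + 2 * (c + 2) ^+ 2 + 13) * (s * ln s) =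
  2 * ((c + 2) * (4 * (s * ln s) + (c + 2) * (s * ln s))) + Cx * (s * ln s)
  + 13 * (s * ln s) by ring.
lra.
Unshelve. all: by end_near.
Qed.
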